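(* For $i\in\{1,2\}$ let $S_i=\{(x,z)\in\mathbb R^{n_i}\times\mathbb Z^{p_i}\mid A_C^ix+A_I^iz\le b^i\}$ be a mixed-integer set with rational data, and let $P_i=\{(x,z)\in\mathbb R^{n_i}\times\mathbb R^{p_i}\mid A_C^ix+A_I^iz\le b^i\}$ be the associated polyhedron. Then $$(P_1\times P_2)_{\mathrm{split}}=(P_1)_{\mathrm{split}}\times(P_2)_{\mathrm{split}},$$ where $P_1\times P_2$ is considered with continuous variables $(x_1,x_2)\in\mathbb R^{n_1}\times\mathbb R^{n_2}$ and integer variables $(z_1,z_2)\in\mathbb Z^{p_1}\times\mathbb Z^{p_2}$.
   Context: For a polyhedron $P\subseteq\mathbb R^n\times\mathbb R^p$ with variables $(x,z)$, $z$ being the integer variables, the split closure is $$P_{\mathrm{split}}=\bigcap_{(\beta,\beta_0)\in\mathbb Z^p\times\mathbb Z}\operatorname{conv}(\{(x,z)\in P\mid\beta^\top z\le\beta_0\}\cup\{(x,z)\in P\mid\beta^\top z\ge\beta_0+1\})=\bigcap_{\beta\in\mathbb Z^p}\operatorname{conv}\{(x,z)\in P\mid\beta^\top z\in\mathbb Z\}.$$ *)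

(* Defs.v *)
From HB Require Import structures.
From mathcomp Require Import all_boot all_order all_algebra.
From mathcomp Require Import all_classical all_reals.
From mathcomp Require Import convex.

Set Implicit Arguments.
Unset Strict Implicit.
Unset Printing Implicit Defensive.

Import Order.TTheory GRing.Theory Num.Theory.

Local Open Scope classical_set_scope.
Local Open Scope ring_scope.

(* A point of R^n x R^p is a pair (x, z), x being the continuous variables and
   z the integer-constrained ones. *)
Notation mixed_space R n p := ('cV[R]_n * 'cV[R]_p)%type.

Definition convex_hull (R : realType) (E : lmodType R) (A : set E) : set E :=
  smallest (@convex_set R E) A.

Definition polyhedron (R : realType) (m n p : nat) (AC : 'M[rat]_(m, n))
    (AI : 'M[rat]_(m, p)) (b : 'cV[rat]_m) : set (mixed_space R n p) :=
  [set u | forall i : 'I_m,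
     (map_mx ratr AC *m u.1 + map_mx ratr AI *m u.2) i 0 <= ratr (b i 0)].

Definition int_dot (R : realType) (p : nat) (beta : 'cV[int]_p)
    (z : 'cV[R]_p) : R :=
  ((map_mx intr beta)^T *m z) 0 0.

Definition split_closure (R : realType) (n p : nat)
    (P : set (mixed_space R n p)) : set (mixed_space R n p) :=
  \bigcap_(s in [set: 'cV[int]_p * int])
    convex_hull
      ([set u | P u /\ int_dot s.1 u.2 <= s.2%:~R] `|`
       [set u | P u /\ s.2%:~R + 1 <= int_dot s.1 u.2]).

(* Cartesian product with the coordinates reordered, so that continuous
   variables are (x1, x2) and integer variables are (z1, z2). *)
Definition mixed_prod (R : realType) (n1 p1 n2 p2 : nat)
    (A : set (mixed_space R n1 p1)) (B : set (mixed_space R n2 p2)) :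
    set (mixed_space R (n1 + n2) (p1 + p2)) :=
  [set (col_mx u.1 v.1, col_mx u.2 v.2) | u in A & v in B].

(* Main.v *)
(** The inclusion from left to right only uses the splits whose integer vector
    is supported on one of the two blocks. For the converse, a point of the
    split closure of a convex set [P] lies, for each integer vector [beta], in
    the hull of the points of [P] where [beta] takes an integer value: a segment
    crossing the split meets both of its boundary hyperplanes. If [u] and [v]
    are in such hulls for [beta1] and [beta2], then the pair is in the hull of
    the product of the two sets, on which [beta1 + beta2] is an integer, so that
    no point of this product is strictly inside a split. *)
From HB Require Import structures.
Require Import Defs.
From mathcomp Require Import all_boot all_order all_algebra.
From mathcomp Require Import all_classical all_reals.
From mathcomp Require Import interval_inference convex ring lra.

Set Implicit Arguments.
Unset Strict Implicit.
Unset Printing Implicit Defensive.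

Import Order.TTheory GRing.Theory Num.Theory.

Local Open Scope classical_set_scope.
Local Open Scope ring_scope.

(** * Convex sets and convex hulls in a real vector space *)

Section ConvexHull.
Context {R : realType}.
Implicit Types E F : lmodType R.

Lemma convex_setP E (A : set E) :
  @convex_set R E A <->
  forall x y (s t : R), A x -> A y -> 0 <= s -> 0 <= t -> s + t = 1 ->
    A (s *: x + t *: y).
Proof.
split=> [cA x y s t Ax Ay s0 t0 st1|cA x y k].
  have s1 : s <= 1 by rewrite -st1 lerDl.
  have /set_mem := cA x y (Itv01 s0 s1) (mem_set Ax) (mem_set Ay).
  by rewrite (_ : t = 1 - s) // -st1 addrC addKr.
move=> /set_mem Ax /set_mem Ay; apply/mem_set; apply: cA => //.
- by rewrite subr_ge0 le1.
- by rewrite addrC subrK.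
Qed.

Lemma convex_hull_convex E (A : set E) : @convex_set R E (convex_hull A).
Proof.
apply/convex_setP => x y s t Ax Ay s0 t0 st B [cB AB].
by move/convex_setP: (cB); apply=> //; [exact: Ax|exact: Ay].
Qed.

Lemma sub_convex_hull E (A : set E) : A `<=` convex_hull A.
Proof. exact: sub_gen_smallest. Qed.

Lemma convex_hull_min E (A B : set E) :
  @convex_set R E B -> A `<=` B -> convex_hull A `<=` B.
Proof. exact: smallest_sub. Qed.

Lemma convex_hull_mono E (A B : set E) :
  A `<=` B -> convex_hull A `<=` convex_hull B.
Proof.
move=> AB; apply: convex_hull_min; first exact: convex_hull_convex.
exact: subset_trans AB (@sub_convex_hull _ _).
Qed.

Lemma convex_preimage E F (f : {linear E -> F}) (B : set F) :
  @convex_set R F B -> @convex_set R E (f @^-1` B).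
Proof.
move=> /convex_setP cB; apply/convex_setP => x y s t Bx By s0 t0 st.
by rewrite /preimage /= linearD !linearZ; apply: cB.
Qed.

Lemma convex_hull_image E F (f : {linear E -> F}) (A : set E) u :
  convex_hull A u -> convex_hull (f @` A) (f u).
Proof.
apply: (@convex_hull_min _ A (f @^-1` convex_hull (f @` A))).
  exact/convex_preimage/convex_hull_convex.
by move=> x Ax; apply: sub_convex_hull; exists x.
Qed.

(** One coordinate moves at a time: for fixed [y] in [B], the points [x] with [(x, y)] in the hull
    form a convex set containing [A]; then [u] is fixed and [y] varies. *)
Lemma convex_hull_prod E F (A : set E) (B : set F) u v :
  convex_hull A u -> convex_hull B v -> convex_hull (A `*` B) (u, v).
Proof.
move=> Au Bv; have /convex_setP cH := @convex_hull_convex _ (A `*` B).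
have HA y : B y -> convex_hull (A `*` B) (u, y).
  move=> By; apply: (convex_hull_min (B := fun x => convex_hull (A `*` B) (x, y))) Au.
    apply/convex_setP => x1 x2 s t h1 h2 s0 t0 st.
    have := cH _ _ _ _ h1 h2 s0 t0 st.
    by congr convex_hull; congr pair; rewrite /= -scalerDl st scale1r.
  by move=> x Ax; apply: sub_convex_hull.
apply: (convex_hull_min (B := fun y => convex_hull (A `*` B) (u, y))) Bv => //.
apply/convex_setP => y1 y2 s t h1 h2 s0 t0 st.
have := cH _ _ _ _ h1 h2 s0 t0 st.
by congr convex_hull; congr pair; rewrite /= -scalerDl st scale1r.
Qed.

(** Merges two weighted points of a convex set into one. Keeping the factor [a + b] on the right
    also covers [a = b = 0], where [x] serves as [z]. *)
Lemma convex_cone_comb E (A : set E) (x y : E) (a b : R) :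
  @convex_set R E A -> A x -> A y -> 0 <= a -> 0 <= b ->
  exists2 z, A z & a *: x + b *: y = (a + b) *: z.
Proof.
move=> /convex_setP cA Ax Ay a0 b0.
have [ab0|ab0] := eqVneq (a + b) 0.
  move/eqP: (ab0); rewrite paddr_eq0 // => /andP[/eqP-> /eqP->].
  by exists x; rewrite // addr0 !scale0r addr0.
exists ((a / (a + b)) *: x + (b / (a + b)) *: y).
  apply: cA; rewrite ?divr_ge0 ?addr_ge0 //.
  by rewrite -mulrDl divff.
by rewrite scalerDr !scalerA !(mulrC (a + b)) !divfK.
Qed.

Definition convex_join E (A B : set E) : set E :=
  [set w | exists x y (s t : R),
     [/\ A x, B y, 0 <= s, 0 <= t & s + t = 1 /\ w = s *: x + t *: y]].

(** In a combination of two points of the join, the two terms from [A] merge into one point of [A],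
    and likewise for [B]. *)
Lemma convex_join_convex E (A B : set E) :
  @convex_set R E A -> @convex_set R E B -> @convex_set R E (convex_join A B).
Proof.
move=> cA cB; apply/convex_setP => w w' c d.
move=> [x [y [s [t [Ax By s0 t0 [st ->]]]]]].
move=> [x' [y' [s' [t' [Ax' By' s'0 t'0 [st' ->]]]]]] c0 d0 cd.
have [z Az ez] := convex_cone_comb cA Ax Ax' (mulr_ge0 c0 s0) (mulr_ge0 d0 s'0).
have [v Bv ev] := convex_cone_comb cB By By' (mulr_ge0 c0 t0) (mulr_ge0 d0 t'0).
exists z, v, (c * s + d * s'), (c * t + d * t').
split; rewrite ?addr_ge0 ?mulr_ge0 //; split.
  by rewrite addrACA -!mulrDr st st' !mulr1.
by rewrite -ez -ev !scalerDr !scalerA addrACA.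
Qed.

(** Nonemptiness provides the opposite endpoint, taken with weight 0, for a point that already lies
    in [A] or in [B]. *)
Lemma convex_hull_setU E (A B : set E) :
  @convex_set R E A -> @convex_set R E B -> A !=set0 -> B !=set0 ->
  convex_hull (A `|` B) `<=` convex_join A B.
Proof.
move=> cA cB [a Aa] [b Bb].
apply: convex_hull_min; first exact: convex_join_convex.
move=> x [Ax|Bx].
  by exists x, b, 1, 0; rewrite scale1r scale0r !addr0.
by exists a, x, 0, 1; rewrite scale1r scale0r !add0r.
Qed.

(** * The two sides of a split, and points where a linear form is an integer *)

Lemma convex_sublevel E (P : set E) (phi : {scalar E}) (c : R) :
  @convex_set R E P -> @convex_set R E [set u | P u /\ phi u <= c].
Proof.
move=> /convex_setP cP; apply/convex_setP.
move=> x y s t [Px hx] [Py hy] s0 t0 st; split; first exact: cP.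
rewrite linearD !linearZ /= -[leRHS]mul1r -st mulrDl.
by rewrite lerD // ler_wpM2l.
Qed.

Lemma convex_superlevel E (P : set E) (phi : {scalar E}) (c : R) :
  @convex_set R E P -> @convex_set R E [set u | P u /\ c <= phi u].
Proof.
move=> /convex_setP cP; apply/convex_setP.
move=> x y s t [Px hx] [Py hy] s0 t0 st; split; first exact: cP.
rewrite linearD !linearZ /= -[leLHS]mul1r -st mulrDl.
by rewrite lerD // ler_wpM2l.
Qed.

(** Only the split at [k], the floor of [phi u], matters: if [phi u] is not an integer, [u] lies
    strictly inside it, on a segment joining its two sides. *)
Lemma split_hull_sub_int_hull E (P : set E) (phi : {scalar E}) (u : E) :
  @convex_set R E P ->
  (forall k : int, convex_hull ([set u | P u /\ phi u <= k%:~R] `|`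
                                [set u | P u /\ k%:~R + 1 <= phi u]) u) ->
  convex_hull [set u | P u /\ phi u \is a Num.int] u.
Proof.
move=> cP; set k := Num.floor (phi u) => /(_ k).
set L := (X in X `|` _); set G := (X in _ `|` X); set Z := [set _ | _].
move=> hu.
have Pu : P u by apply: convex_hull_min hu => // x [] [].
have [phi_int|phi_nint] := boolP (phi u \is a Num.int).
  exact: sub_convex_hull.
have ltk : k%:~R < phi u by rewrite lt_neqAle floor_le_tmp -intrEfloor phi_nint.
have ltk1 : phi u < k%:~R + 1 by rewrite -intrD1 floorD1_gt.
have cL : @convex_set R E L by exact: convex_sublevel.
have cG : @convex_set R E G by exact: convex_superlevel.
(* If one side were empty, [u] would lie in the other, which is convex, against [ltk] or [ltk1]. *)
have L0 : L !=set0.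
  apply/set0P; apply/eqP => L0; move: hu; rewrite L0 set0U.
  by move=> /(convex_hull_min cG (@subset_refl _ _))[_]; rewrite leNgt ltk1.
have G0 : G !=set0.
  apply/set0P; apply/eqP => G0; move: hu; rewrite G0 setU0.
  by move=> /(convex_hull_min cL (@subset_refl _ _))[_]; rewrite leNgt ltk.
have [a [b [s [t [[Pa ak] [Pb kb] s0 t0 [st ue]]]]]] :=
  convex_hull_setU cL cG L0 G0 hu.
have phiu : phi u = s * phi a + t * phi b by rewrite ue linearD !linearZ.
have te : t = 1 - s by rewrite -st addrC addKr.
have ab : 0 < phi b - phi a by lra.
have ab0 : phi b - phi a != 0 by rewrite gt_eqF.
have /convex_setP cZ := @convex_hull_convex _ Z.
(* The point of the line through [a] and [b] where [phi] equals [c]. *)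
pose cross c := ((phi b - c) / (phi b - phi a)) *: a +
                ((c - phi a) / (phi b - phi a)) *: b.
have crossZ (m : int) :
    phi a <= m%:~R -> m%:~R <= phi b -> convex_hull Z (cross m%:~R).
  move=> am mb; apply: sub_convex_hull; split.
    move/convex_setP: cP; apply=> //; rewrite ?divr_ge0 ?(ltW ab) ?subr_ge0 //.
    by field.
  rewrite /cross linearD !linearZ /= (_ : _ + _ = m%:~R) ?intr_int //.
  by field.
(* [cross] is affine in its argument and [u] is [cross (phi u)], so the weights are those that
   express [phi u] through [k] and [k + 1]. *)
have -> : u = (k%:~R + 1 - phi u) *: cross k%:~R
            + (phi u - k%:~R) *: cross (k + 1)%:~R.
  rewrite /cross !scalerDr !scalerA addrACA -!scalerDl [LHS]ue intrD.
  by congr (_ *: _ + _ *: _); rewrite phiu te; field.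
apply: cZ; [apply: crossZ|apply: crossZ| | |]; rewrite ?intrD; lra.
Qed.

End ConvexHull.

Arguments convex_hull_image {R E F} f {A u}.

(** * Polyhedra and integer linear forms on the mixed space *)

Section MixedSpace.
Context {R : realType}.

Lemma polyhedron_convex m n p (AC : 'M[rat]_(m, n)) (AI : 'M[rat]_(m, p))
    (b : 'cV[rat]_m) : @convex_set R (mixed_space R n p) (polyhedron AC AI b).
Proof.
apply/convex_setP => x y s t Px Py s0 t0 st i.
move: (Px i) (Py i); rewrite /= !mulmxDr -!scalemxAr !mxE => hx hy.
rewrite -[leRHS]mul1r -st mulrDl addrACA -!mulrDr.
by rewrite lerD // ler_wpM2l.
Qed.

Section IntDot.
Context {n p : nat}.
Variable beta : 'cV[int]_p.

(** A function of the whole point, so that it can be declared a linear form and used as [phi]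
    above. *)
Definition mixed_dot (u : mixed_space R n p) : R := int_dot beta u.2.

Lemma mixed_dot_is_scalar : scalar mixed_dot.
Proof. by move=> a u v; rewrite /mixed_dot /int_dot /= mulmxDr -scalemxAr !mxE. Qed.

HB.instance Definition _ :=
  GRing.isLinear.Build R (mixed_space R n p) R *%R mixed_dot mixed_dot_is_scalar.

End IntDot.

Lemma int_dot_col_mx p1 p2 (beta1 : 'cV[int]_p1) (beta2 : 'cV[int]_p2)
    (z1 : 'cV[R]_p1) (z2 : 'cV[R]_p2) :
  int_dot (col_mx beta1 beta2) (col_mx z1 z2) =
  int_dot beta1 z1 + int_dot beta2 z2.
Proof. by rewrite /int_dot map_col_mx tr_col_mx mul_row_col mxE. Qed.

Lemma int_dot0 p (z : 'cV[R]_p) : int_dot 0 z = 0.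
Proof. by rewrite /int_dot map_mx0 trmx0 mul0mx mxE. Qed.

(** * Products of mixed spaces and the two inclusions *)

Section MixedPair.
Context {n1 p1 n2 p2 : nat}.
Local Notation E1 := (mixed_space R n1 p1).
Local Notation E2 := (mixed_space R n2 p2).
Local Notation E12 := (mixed_space R (n1 + n2) (p1 + p2)).

(** The reordering of coordinates behind [mixed_prod], as a linear map along which hulls can be
    transported. *)
Definition mixed_pair (w : E1 * E2) : E12 :=
  (col_mx w.1.1 w.2.1, col_mx w.1.2 w.2.2).
Definition mixed_fst (w : E12) : E1 := (usubmx w.1, usubmx w.2).
Definition mixed_snd (w : E12) : E2 := (dsubmx w.1, dsubmx w.2).

Lemma mixed_fst_pair (u : E1) (v : E2) :
   mixed_fst (col_mx u.1 v.1, col_mx u.2 v.2) = u.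
Proof. by case: u => x z; rewrite /mixed_fst !col_mxKu. Qed.

Lemma mixed_snd_pair (u : E1) (v : E2) :
   mixed_snd (col_mx u.1 v.1, col_mx u.2 v.2) = v.
Proof. by case: v => x z; rewrite /mixed_snd !col_mxKd. Qed.

Lemma mixed_pair_is_linear : linear mixed_pair.
Proof.
by move=> a u v; congr pair; rewrite /= scale_col_mx add_col_mx.
Qed.

Lemma mixed_fst_is_linear : linear mixed_fst.
Proof. by move=> a u v; congr pair; rewrite /= linearP. Qed.

Lemma mixed_snd_is_linear : linear mixed_snd.
Proof. by move=> a u v; congr pair; rewrite /= linearP. Qed.

HB.instance Definition _ :=
  GRing.isLinear.Build R (E1 * E2)%type E12 *:%R mixed_pair mixed_pair_is_linear.
HB.instance Definition _ :=
  GRing.isLinear.Build R E12 E1 *:%R mixed_fst mixed_fst_is_linear.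
HB.instance Definition _ :=
  GRing.isLinear.Build R E12 E2 *:%R mixed_snd mixed_snd_is_linear.

(** Padding [beta] with zeros lifts a split of one factor to the product; the projection sends each
    side of the lifted split into the same side of the original one. *)
Lemma split_closure_mixed_prod_sub (P1 : set E1) (P2 : set E2) :
  split_closure (mixed_prod P1 P2) `<=`
  mixed_prod (split_closure P1) (split_closure P2).
Proof.
move=> w hw; exists (mixed_fst w); last exists (mixed_snd w); last first.
- by rewrite /= !vsubmxK; case: w {hw}.
- move=> [beta k] _; apply: convex_hull_mono
    (convex_hull_image mixed_snd (hw (col_mx 0 beta, k) I)).
  move=> _ [_ [] [[u Pu [v Pv <-]] h] <-]; [left|right]; move: h;
    by rewrite /= mixed_snd_pair col_mxKd int_dot_col_mx int_dot0 add0r.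
- move=> [beta k] _; apply: convex_hull_mono
    (convex_hull_image mixed_fst (hw (col_mx beta 0, k) I)).
  move=> _ [_ [] [[u Pu [v Pv <-]] h] <-]; [left|right]; move: h;
    by rewrite /= mixed_fst_pair col_mxKu int_dot_col_mx int_dot0 addr0.
Qed.

Lemma mixed_prod_split_closure_sub (P1 : set E1) (P2 : set E2) :
  @convex_set R E1 P1 -> @convex_set R E2 P2 ->
  mixed_prod (split_closure P1) (split_closure P2) `<=`
  split_closure (mixed_prod P1 P2).
Proof.
move=> cP1 cP2 _ [u hu [v hv <-]] [beta k] _.
pose beta1 := usubmx beta; pose beta2 := dsubmx beta.
(* All offsets [j] are needed here, not just [k]: the relevant one depends on the point [u]. *)
have {}hu : convex_hull [set u | P1 u /\ mixed_dot beta1 u \is a Num.int] u.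
  by apply: split_hull_sub_int_hull => // j; exact: (hu (beta1, j) I).
have {}hv : convex_hull [set v | P2 v /\ mixed_dot beta2 v \is a Num.int] v.
  by apply: split_hull_sub_int_hull => // j; exact: (hv (beta2, j) I).
apply: convex_hull_mono
  (convex_hull_image mixed_pair (convex_hull_prod hu hv)).
move=> _ [[x y] [[/= Px /intrP[i xi]] [/= Py /intrP[j yj]]] <-].
have dot_xy : int_dot beta (col_mx x.2 y.2) = (i + j)%:~R.
  by rewrite -[beta]vsubmxK int_dot_col_mx intrD -xi -yj.
have Pxy : mixed_prod P1 P2 (mixed_pair (x, y)) by exists x => //; exists y.
(* The comparison takes place in the integers, where [k < i + j] already gives [k + 1 <= i + j]. *)
have [le_k|lt_k] := leP (i + j) k; [left|right]; split => //=; rewrite dot_xy.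
  by rewrite ler_int.
by rewrite -intrD1 ler_int -ltzD1 ltrD2r.
Qed.

End MixedPair.
End MixedSpace.

Theorem theorem5p5 (R : realType) (n1 p1 m1 n2 p2 m2 : nat)
  (AC1 : 'M[rat]_(m1, n1)) (AI1 : 'M[rat]_(m1, p1)) (b1 : 'cV[rat]_m1)
  (AC2 : 'M[rat]_(m2, n2)) (AI2 : 'M[rat]_(m2, p2)) (b2 : 'cV[rat]_m2) :
  let P1 : set (mixed_space R n1 p1) := polyhedron AC1 AI1 b1 in
  let P2 : set (mixed_space R n2 p2) := polyhedron AC2 AI2 b2 in
  split_closure (mixed_prod P1 P2) =
  mixed_prod (split_closure P1) (split_closure P2).
Proof.
move=> P1 P2; apply/seteqP; split; first exact: split_closure_mixed_prod_sub.
by apply: mixed_prod_split_closure_sub; exact: polyhedron_convex.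
Qed.
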